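(* Consider the $k$-delete recoverable robust problem under budgeted uncertainty $$(\mathrm{P})\qquad \min_{x\in X}\ f^\top x+\max_{s\in S} R(x,s).$$ It can be solved as the (mixed-integer linear) problem $$(\mathrm{Q})\qquad \begin{aligned}\min_{x,\eta,w,z}\quad & f^\top x+\eta\\ \text{s.t.}\quad & \eta\ \ge\ \sum_{i=1}^n \bar c_i(\nu)x_i+\Gamma w^\nu+\sum_{i=1}^n z_i^\nu-k\nu,\qquad \nu\in\mathcal V,\\ & w^\nu+z_i^\nu\ \ge\ \Delta c_i(\nu)x_i,\qquad i\in N,\ \nu\in\mathcal V,\\ & x\in X,\ \eta\in\mathbb R_{\ge0},\ w^\nu\in\mathbb R_{\ge0},\ z^\nu\in\mathbb R^n_{\ge0},\qquad \nu\in\mathcal V.\end{aligned}$$ That is, (P) and (Q) have the same optimal value, and $x^*\in X$ is optimal for (P) if and only if there are $\eta^*,w^*,z^*$ such that $(x^*,\eta^*,w^*,z^* )$ is optimal for (Q).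
   Context: Data: $n\ge 1$ an integer, $N=\{1,\dots,n\}$; $X\subseteq\{0,1\}^n$ nonempty; $f,\bar c,\Delta c\in\mathbb R^n_{\ge 0}$ (first-stage costs, nominal recovery costs, maximal deviations); $\Gamma,k\in\{0,\dots,n\}$. Budgeted uncertainty: $\mathcal U_\Gamma=\{u\in\{0,1\}^n:\sum_{i=1}^n u_i\le\Gamma\}=\{u^1,\dots,u^M\}$. The scenario set is $S=\{1,\dots,M\}$, where scenario $s$ has costs $c_i^s=\bar c_i+\Delta c_i u_i^s$, $i\in N$. Recovery cost: for $x\in X$, $s\in S$, $$R(x,s)=\min_y\Big\{\sum_{i=1}^n c_i^s y_i:\ y\le x,\ \sum_{i=1}^n y_i\ge\sum_{i=1}^n x_i-k,\ y\in\{0,1\}^n\Big\}.$$ Define $\mathcal V=\{0\}\cup\{\bar c_i:i\in N\}\cup\{\bar c_i+\Delta c_i:i\in N\}$. For $\nu\in\mathcal V$ and $i\in N$ let $c_i(\nu)=\min\{\Delta c_i,\nu-\bar c_i\}$, $$\bar c_i(\nu)=\begin{cases}\nu,&\nu<\bar c_i,\\ \bar c_i,&\nu\ge\bar c_i,\end{cases}\qquad \Delta c_i(\nu)=\begin{cases}0,&\nu<\bar c_i,\\ c_i(\nu),&\nu\ge\bar c_i.\end{cases}$$ Here $\Delta c_i$ without argument is the given deviation, and $\Delta c_i(\nu)$ is the function just defined (likewise for $\bar c_i$ and $\bar c_i(\nu)$). In (Q), $w=(w^\nu)_{\nu\in\mathcal V}$ and $z=(z^\nu)_{\nu\in\mathcal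 V}$. *)

(* Defs.v *)
From mathcomp Require Import all_boot all_order all_algebra.
From mathcomp Require Import reals.

Set Implicit Arguments.
Unset Strict Implicit.
Unset Printing Implicit Defensive.

Import Order.TTheory GRing.Theory Num.Theory.
Local Open Scope ring_scope.

Definition is_optimal (R : realType) (T : Type)
    (feas : T -> Prop) (obj : T -> R) (t : T) : Prop :=
  feas t /\ (forall t', feas t' -> obj t <= obj t').

(* The optimal value is attained: it is a minimum, not merely an infimum. *)
Definition is_optimal_value (R : realType) (T : Type)
    (feas : T -> Prop) (obj : T -> R) (v : R) : Prop :=
  exists2 t, is_optimal feas obj t & obj t = v.

(* {0,1}^n; a coordinate [x i : bool] coerces to the natural number 0 or 1. *)
Definition binvec (n : nat) := {ffun 'I_n -> bool}.

Definition budgeted (n Gamma : nat) : {set binvec n} :=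
  [set u : binvec n | (\sum_i u i <= Gamma)%N].

Lemma zero_budgeted (n Gamma : nat) :
  [ffun=> false] \in budgeted n Gamma.
Proof. by rewrite inE big1 // => i _; rewrite ffunE. Qed.

(* S = {1, ..., M}, where M is the number of budgeted vectors u^1, ..., u^M. *)
Definition scenario (n Gamma : nat) : Type := 'I_#|budgeted n Gamma|.

Definition scenario_vec (n Gamma : nat) (s : scenario n Gamma) : binvec n :=
  enum_val s.

(* The scenario of the zero vector; it only witnesses that S is nonempty. *)
Definition scenario0 (n Gamma : nat) : scenario n Gamma :=
  enum_rank_in (zero_budgeted n Gamma) [ffun=> false].

Definition scenario_cost (R : realType) (n Gamma : nat)
    (cbar dc : 'I_n -> R) (s : scenario n Gamma) (i : 'I_n) : R :=
  cbar i + dc i * (scenario_vec s i)%:R.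

(* The bound sum y >= sum x - k is moved to the other side, because
   subtraction on nat is truncated. *)
Definition recovery_feasible (n k : nat) (x : binvec n) : {set binvec n} :=
  [set y : binvec n | [forall i, (y i <= x i)%N]
                      && (\sum_i x i <= \sum_i y i + k)%N].

(* [arg min] and [arg max] need a feasible starting point: here y = x for the
   recovery problem, and [scenario0] for the maximum over S. *)
Definition recovery_cost (R : realType) (n Gamma k : nat)
    (cbar dc : 'I_n -> R) (x : binvec n) (s : scenario n Gamma) : R :=
  let cost (y : binvec n) := \sum_i scenario_cost cbar dc s i * (y i)%:R in
  cost [arg min_(y < x in recovery_feasible k x) cost y]%O.

Definition worst_recovery_cost (R : realType) (n Gamma k : nat)
    (cbar dc : 'I_n -> R) (x : binvec n) : R :=
  let cost (s : scenario n Gamma) := recovery_cost k cbar dc x s in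
  cost [arg max_(s > scenario0 n Gamma) cost s]%O.

Definition P_feasible (n : nat) (X : {set binvec n}) (x : binvec n) : Prop :=
  x \in X.

Definition P_objective (R : realType) (n Gamma k : nat)
    (f cbar dc : 'I_n -> R) (x : binvec n) : R :=
  \sum_i f i * (x i)%:R + worst_recovery_cost Gamma k cbar dc x.

Definition breakpoints (R : realType) (n : nat) (cbar dc : 'I_n -> R) : seq R :=
  0 :: [seq cbar i | i : 'I_n] ++ [seq cbar i + dc i | i : 'I_n].

(* The finite set V, as a type; repetitions in the list are irrelevant. *)
Definition breakpoint (R : realType) (n : nat) (cbar dc : 'I_n -> R) : Type :=
  seq_sub (breakpoints cbar dc).

Definition cbar_at (R : realType) (n : nat) (cbar : 'I_n -> R)
    (nu : R) (i : 'I_n) : R :=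
  if nu < cbar i then nu else cbar i.

Definition c_at (R : realType) (n : nat) (cbar dc : 'I_n -> R)
    (nu : R) (i : 'I_n) : R :=
  Num.min (dc i) (nu - cbar i).

Definition dc_at (R : realType) (n : nat) (cbar dc : 'I_n -> R)
    (nu : R) (i : 'I_n) : R :=
  if nu < cbar i then 0 else c_at cbar dc nu i.

Record Q_point (R : realType) (n : nat) (cbar dc : 'I_n -> R) : Type := QPoint {
  Q_x : binvec n;
  Q_eta : R;
  Q_w : breakpoint cbar dc -> R;
  Q_z : breakpoint cbar dc -> 'I_n -> R
}.

Definition Q_feasible (R : realType) (n Gamma k : nat) (X : {set binvec n})
    (cbar dc : 'I_n -> R) (p : Q_point cbar dc) : Prop :=
  let: QPoint x eta w z := p in
  [/\ forall nu : breakpoint cbar dc,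
        eta >= \sum_i cbar_at cbar (ssval nu) i * (x i)%:R
               + Gamma%:R * w nu + \sum_i z nu i - k%:R * ssval nu,
      forall (i : 'I_n) (nu : breakpoint cbar dc),
        w nu + z nu i >= dc_at cbar dc (ssval nu) i * (x i)%:R,
      x \in X,
      eta >= 0
    & forall nu : breakpoint cbar dc, w nu >= 0 /\ (forall i, z nu i >= 0)].

Definition Q_objective (R : realType) (n : nat) (f cbar dc : 'I_n -> R)
    (p : Q_point cbar dc) : R :=
  \sum_i f i * (Q_x p i)%:R + Q_eta p.

(* Main.v *)
Require Import Defs.
From mathcomp Require Import all_boot all_order all_algebra.
From mathcomp Require Import boolp reals.
From mathcomp Require Import lra.
Set Implicit Arguments.
Unset Strict Implicit.
Unset Printing Implicit Defensive.

Import Order.TTheory GRing.Theory Num.Theory.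
Local Open Scope ring_scope.

(** The proof is two linear-programming dualities, each with an explicit primal
    and dual optimum obtained by cutting a finite family at a threshold value.

    Fix x.  For a fixed scenario with costs c, recovery keeps the cheapest items
    of x and deletes up to k of them.  Dualising the cardinality constraint with a
    multiplier nu >= 0 gives the bound
      sum_i min(c_i, nu) x_i - k nu,
    valid for each nu ([recovery_weak_duality]) and attained when nu is the cost
    of the most expensive kept item, or 0 if nothing needs to be kept
    ([recovery_strong_duality]).  Since every scenario cost is cbar_i or
    cbar_i + dc_i, the best multiplier can always be found among the
    breakpoints, a set that does not depend on the scenario.  So the maximum
    over s and the maximum over nu can be exchanged.

    For a fixed nu, the truncated cost min(cbar_i + dc_i u_i, nu) is affine in
    the binary u_i, with the coefficients cbar_at and dc_at ([truncated_costE]).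
    The worst scenario for this nu therefore picks the Gamma largest values
    dc_at x_i, and the dual of this selection is exactly the pair (w, z) of the
    mixed-integer program ([budget_weak_duality], [budget_strong_duality]).

    It follows that, over a fixed x, each feasible eta of (Q) is at least the
    worst recovery cost of x ([worst_recovery_cost_le_eta]) and that this cost is
    itself a feasible eta ([Q_feasible_lift]).  Thus (P) is the projection of
    (Q) on x, which gives both claims. *)

(** * Cutting a finite family at a threshold *)

(** Adding the smallest remaining element one at a time keeps the invariant; the
    threshold is the smallest value outside the previous selection, so it is
    always one of the values of the family. *)
Lemma threshold_selection (R : realType) (T : finType) (a : T -> R)
    (A : {set T}) (m : nat) :
  A != set0 -> (m <= #|A|)%N ->
  exists (B : {set T}) (j : T),
    [/\ B \subset A, #|B| = m, j \in A,
        forall i, i \in B -> a i <= a j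
      & forall i, i \in A -> i \notin B -> a j <= a i].
Proof.
move=> /set0Pn[i0 Ai0]; elim: m => [_|m IH ltmA].
  exists set0; case: (arg_minP a Ai0) => j Aj minj; exists j.
  split; rewrite ?sub0set ?cards0 //; move=> i; rewrite ?in_set0 //.
  by move=> Ai _; apply: minj.
have [B [j0 [sBA cardB Aj0 leB geB]]] := IH (ltnW ltmA).
have [i1 Di1] : exists i, i \in A :\: B.
  by apply/set0Pn; rewrite -card_gt0 cardsD (setIidPr sBA) cardB subn_gt0.
case: (arg_minP a Di1) => j Dj minj.
have /setDP[Aj nBj] := Dj.
exists (j |: B), j; split=> //.
- by rewrite subUset sub1set Aj.
- by rewrite cardsU1 nBj cardB.
- move=> i /setU1P[-> //|Bi].
  exact: le_trans (leB i Bi) (geB j Aj nBj).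
- move=> i Ai; rewrite in_setU1 negb_or => /andP[_ nBi].
  by apply: minj; apply/setDP.
Qed.

Lemma sum_nat_mem (n : nat) (B : {set 'I_n}) : (\sum_i (i \in B) = #|B|)%N.
Proof. by rewrite -sum1_card -big_mkcond. Qed.

(** * Duality for the selection of a bounded number of items *)

Lemma budget_weak_duality (R : realType) (n Gamma : nat) (d z : 'I_n -> R)
    (w : R) (u : binvec n) :
  u \in budgeted n Gamma -> 0 <= w -> (forall i, 0 <= z i) ->
  (forall i, d i <= w + z i) ->
  \sum_i d i * (u i)%:R <= Gamma%:R * w + \sum_i z i.
Proof.
rewrite inE => hu w0 z0 hd.
apply: (@le_trans _ _ (\sum_i ((u i)%:R * w + z i))).
  apply: ler_sum => i _; have := hd i; have := z0 i.
  by case: (u i) => /=; lra.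
by rewrite big_split /= lerD2r -mulr_suml -natr_sum ler_wpM2r // ler_nat.
Qed.

(** The worst u takes the Gamma largest d_i, and w is the smallest of them (the
    largest value overall if Gamma = 0).  Only w is an unknown of the dual: the
    best z is the excess of d over w. *)
Lemma budget_strong_duality (R : realType) (n Gamma : nat) (d : 'I_n -> R) :
  (1 <= n)%N -> (Gamma <= n)%N -> (forall i, 0 <= d i) ->
  exists (u : binvec n) (w : R),
    [/\ u \in budgeted n Gamma, 0 <= w
      & Gamma%:R * w + \sum_i Num.max 0 (d i - w) = \sum_i d i * (u i)%:R].
Proof.
move=> n0 leGn d0.
have [||B [j [_ cardB _ leB geB]]] :=
  @threshold_selection R 'I_n (fun i => - d i) setT Gamma.
- by rewrite -card_gt0 cardsT card_ord.
- by rewrite cardsT card_ord.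
have sumB : (\sum_i [ffun i => i \in B] i = Gamma)%N.
  by rewrite -cardB -sum_nat_mem; apply: eq_bigr => i _; rewrite ffunE.
exists [ffun i => i \in B], (d j); split=> //; first by rewrite inE sumB.
rewrite -{1}sumB natr_sum mulr_suml -big_split /=.
apply: eq_bigr => i _; rewrite ffunE.
case: (boolP (i \in B)) => [/leB|/(geB i (in_setT i))] /= h.
  by rewrite max_r; lra.
by rewrite max_l; lra.
Qed.

(** * Duality for the recovery problem *)

(** An item of x that is dropped contributes at most nu to the truncated sum,
    and at most k items are dropped. *)
Lemma recovery_weak_duality (R : realType) (n k : nat) (c : 'I_n -> R)
    (x y : binvec n) (nu : R) :
  0 <= nu -> y \in recovery_feasible k x ->
  \sum_i Num.min (c i) nu * (x i)%:R - k%:R * nu <= \sum_i c i * (y i)%:R.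
Proof.
move=> nu0; rewrite inE => /andP[/forallP leyx lek].
have : \sum_i Num.min (c i) nu * (x i)%:R
       <= \sum_i (c i * (y i)%:R + ((x i)%:R * nu - (y i)%:R * nu)).
  apply: ler_sum => i _; move: (leyx i).
  have h1 : Num.min (c i) nu <= c i by rewrite ge_min lexx.
  have h2 : Num.min (c i) nu <= nu by rewrite ge_min lexx orbT.
  by case: (x i); case: (y i) => //= _; lra.
rewrite big_split sumrB /= -!mulr_suml -!natr_sum.
have : (\sum_i x i)%:R * nu <= (\sum_i y i + k)%:R * nu.
  by rewrite ler_wpM2r // ler_nat.
by rewrite natrD; lra.
Qed.

Lemma recovery_strong_duality (R : realType) (n k : nat) (c : 'I_n -> R)
    (x : binvec n) :
  (forall i, 0 <= c i) ->
  exists (y : binvec n) (nu : R),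
    [/\ y \in recovery_feasible k x, nu = 0 \/ (exists i, nu = c i)
      & \sum_i c i * (y i)%:R
        = \sum_i Num.min (c i) nu * (x i)%:R - k%:R * nu].
Proof.
move=> c0; pose A := [set i | x i].
have sumx : (\sum_i x i = #|A|)%N.
  by rewrite -sum_nat_mem; apply: eq_bigr => i _; rewrite inE.
have [leAk|ltkA] := leqP #|A| k.
  exists [ffun=> false], 0; split; last 1 first.
  - rewrite mulr0 subr0 !big1 // => i _; last by rewrite ffunE mulr0.
    by rewrite min_r ?mul0r.
  - rewrite inE sumx; apply/andP; split; first by apply/forallP=> i; rewrite ffunE.
    exact: leq_trans leAk (leq_addl _ _).
  - by left.
have [||B [j [sBA cardB _ leB geB]]] :=
  @threshold_selection R 'I_n c A (#|A| - k).
- by rewrite -card_gt0 (leq_ltn_trans _ ltkA).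
- exact: leq_subr.
have sumB : (\sum_i [ffun i => i \in B] i = #|A| - k)%N.
  by rewrite -cardB -sum_nat_mem; apply: eq_bigr => i _; rewrite ffunE.
exists [ffun i => i \in B], (c j); split; last 1 first.
- have -> : k%:R = \sum_i (x i)%:R - \sum_i ([ffun i => i \in B] i)%:R :> R.
    by rewrite -!natr_sum sumB sumx -natrB ?leq_subr // subKn // ltnW.
  rewrite mulrBl !mulr_suml -!sumrB; apply: eq_bigr => i _; rewrite ffunE.
  case: (boolP (i \in B)) => [Bi|nBi] /=.
    have := subsetP sBA i Bi; rewrite inE => ->.
    by rewrite min_l ?leB //=; lra.
  case: (boolP (x i)) => [xi|nxi] /=; last by lra.
  by rewrite min_r ?geB ?inE //; lra.
- rewrite inE sumx sumB subnK ?(ltnW ltkA) // leqnn andbT.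
  apply/forallP => i; rewrite ffunE.
  by case: (boolP (i \in B)) => // /(subsetP sBA); rewrite inE => ->.
- by right; exists j.
Qed.

Section Reformulation.

Variables (R : realType) (n Gamma k : nat) (cbar dc : 'I_n -> R).
Hypothesis cbar0 : forall i, 0 <= cbar i.
Hypothesis dc0 : forall i, 0 <= dc i.

Implicit Types (x : binvec n) (s : scenario n Gamma) (nu : R).

(** * Worst-case recovery cost *)

(** For nu < cbar_i the deviation is invisible after truncation; otherwise the
    truncation only caps it at nu - cbar_i. *)
Lemma truncated_costE s nu i :
  Num.min (scenario_cost cbar dc s i) nu
  = cbar_at cbar nu i + dc_at cbar dc nu i * (scenario_vec s i)%:R.
Proof.
rewrite /scenario_cost /cbar_at /dc_at /c_at; have := dc0 i.
case: ltP => h d0; case: (scenario_vec s i) => /=; rewrite ?mulr1 ?mulr0 ?addr0.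
- by rewrite min_r //; lra.
- by rewrite min_r //; lra.
- by rewrite addr_minr; congr Num.min; lra.
- by rewrite min_l.
Qed.

Lemma truncated_sumE x s nu :
  \sum_i Num.min (scenario_cost cbar dc s i) nu * (x i)%:R
  = \sum_i cbar_at cbar nu i * (x i)%:R
    + \sum_i dc_at cbar dc nu i * (x i)%:R * (scenario_vec s i)%:R.
Proof.
rewrite -big_split /=; apply: eq_bigr => i _.
by rewrite truncated_costE mulrDl mulrAC.
Qed.

Lemma dc_at_ge0 nu i : 0 <= dc_at cbar dc nu i.
Proof.
rewrite /dc_at /c_at; case: ltP => // h.
by rewrite le_min dc0 subr_ge0.
Qed.

Lemma breakpoint_ge0 (nu : breakpoint cbar dc) : 0 <= ssval nu.
Proof.
have := ssvalP nu; rewrite inE mem_cat => /predU1P[-> //|/orP[]] /mapP[i _ ->] //.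
exact: addr_ge0.
Qed.

Lemma scenario_cost_ge0 s i : 0 <= scenario_cost cbar dc s i.
Proof. by rewrite addr_ge0 // mulr_ge0 ?ler0n. Qed.

Lemma scenario_cost_breakpoint s i :
  scenario_cost cbar dc s i \in breakpoints cbar dc.
Proof.
rewrite /scenario_cost inE mem_cat; apply/orP; right; apply/orP.
case: (scenario_vec s i); rewrite /= ?mulr1 ?mulr0 ?addr0.
  by right; apply/mapP; exists i; rewrite // mem_enum.
by left; apply/mapP; exists i; rewrite // mem_enum.
Qed.

Lemma self_recovery_feasible x : x \in recovery_feasible k x.
Proof. by rewrite inE leq_addr andbT; apply/forallP => i. Qed.

Lemma recovery_cost_attained x s :
  exists2 y, y \in recovery_feasible k x
    & recovery_cost k cbar dc x s
      = \sum_i scenario_cost cbar dc s i * (y i)%:R.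
Proof.
rewrite /recovery_cost; case: arg_minP => [|y Fy _].
  exact: self_recovery_feasible.
by exists y.
Qed.

Lemma recovery_cost_le x s y : y \in recovery_feasible k x ->
  recovery_cost k cbar dc x s <= \sum_i scenario_cost cbar dc s i * (y i)%:R.
Proof.
rewrite /recovery_cost; case: arg_minP => [|y' _ miny'].
  exact: self_recovery_feasible.
exact: miny'.
Qed.

Lemma recovery_cost_ge0 x s : 0 <= recovery_cost k cbar dc x s.
Proof.
have [y _ ->] := recovery_cost_attained x s.
by apply: sumr_ge0 => i _; rewrite mulr_ge0 ?scenario_cost_ge0 ?ler0n.
Qed.

Lemma worst_recovery_cost_attained x :
  exists s, worst_recovery_cost Gamma k cbar dc x = recovery_cost k cbar dc x s.
Proof. by rewrite /worst_recovery_cost; eexists. Qed.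

Lemma recovery_cost_le_worst x s :
  recovery_cost k cbar dc x s <= worst_recovery_cost Gamma k cbar dc x.
Proof.
by rewrite /worst_recovery_cost; case: arg_maxP => // s' _ maxs'; apply: maxs'.
Qed.

(** * The two problems over a fixed first-stage solution *)

(** For the worst scenario, the constraint of (Q) at the optimal multiplier of
    its recovery problem already forces the bound. *)
Lemma worst_recovery_cost_le_eta (X : {set binvec n})
    (p : Q_point cbar dc) :
  @Q_feasible R n Gamma k X cbar dc p ->
  worst_recovery_cost Gamma k cbar dc (Q_x p) <= Q_eta p.
Proof.
case: p => x eta w z /= [heta hwz _ _ hpos].
have [s ->] := worst_recovery_cost_attained x.
have [y [nu [Fy hnu eqy]]] := recovery_strong_duality k x (scenario_cost_ge0 s).
have Vnu : nu \in breakpoints cbar dc.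
  by case: hnu => [->|[i ->]]; [rewrite inE eqxx | exact: scenario_cost_breakpoint].
apply: le_trans (recovery_cost_le s Fy) _.
pose b : breakpoint cbar dc := SeqSub Vnu.
apply: le_trans (heta b); rewrite eqy truncated_sumE lerD2r -addrA lerD2l.
have [w0 z0] := hpos b.
apply: budget_weak_duality => // [|i]; first exact: enum_valP.
exact: hwz i b.
Qed.

(** At each breakpoint the optimal dual (w, z) makes the right-hand side of the
    constraint equal to the truncated sum of some scenario, which is at most the
    recovery cost of that scenario. *)
Lemma Q_feasible_lift (X : {set binvec n}) x :
  (1 <= n)%N -> (Gamma <= n)%N -> x \in X ->
  exists (w : breakpoint cbar dc -> R) (z : breakpoint cbar dc -> 'I_n -> R),
    @Q_feasible R n Gamma k X cbar dc
      (QPoint x (worst_recovery_cost Gamma k cbar dc x) w z).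
Proof.
move=> n0 leGn Xx.
pose d (b : breakpoint cbar dc) i := dc_at cbar dc (ssval b) i * (x i)%:R.
have d0 b i : 0 <= d b i by rewrite mulr_ge0 ?dc_at_ge0 ?ler0n.
have /choice[w hw] : forall b, exists w, exists u : binvec n,
    [/\ u \in budgeted n Gamma, 0 <= w
      & Gamma%:R * w + \sum_i Num.max 0 (d b i - w) = \sum_i d b i * (u i)%:R].
  move=> b; have [u [w hw]] := budget_strong_duality n0 leGn (d0 b).
  by exists w, u.
exists w, (fun b i => Num.max 0 (d b i - w b)); split=> //.
- move=> b; have [u [Gu _ equ]] := hw b.
  pose s : scenario n Gamma := enum_rank_in Gu u.
  have sE : scenario_vec s = u by rewrite /scenario_vec enum_rankK_in.
  rewrite -(addrA (\sum_i _)) equ -sE -truncated_sumE.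
  apply: le_trans (recovery_cost_le_worst x s).
  have [y Fy ->] := recovery_cost_attained x s.
  exact: recovery_weak_duality (breakpoint_ge0 b) Fy.
- by move=> i b; rewrite -/(d b i) addr_maxr le_max [w b + (_ - _)]addrC subrK lexx orbT.
- have [s ->] := worst_recovery_cost_attained x; exact: recovery_cost_ge0.
- move=> b; have [u [_ w0 _]] := hw b; split=> // i.
  by rewrite le_max lexx.
Qed.

End Reformulation.

Theorem theorem2 (R : realType) (n : nat) (hn : (1 <= n)%N)
    (X : {set binvec n}) (hX : X != set0)
    (f cbar dc : 'I_n -> R)
    (hf : forall i, 0 <= f i) (hcbar : forall i, 0 <= cbar i)
    (hdc : forall i, 0 <= dc i)
    (Gamma k : nat) (hGamma : (Gamma <= n)%N) (hk : (k <= n)%N) :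
  (exists v : R,
     is_optimal_value (P_feasible X) (P_objective Gamma k f cbar dc) v /\
     is_optimal_value (@Q_feasible R n Gamma k X cbar dc)
                      (@Q_objective R n f cbar dc) v) /\
  (forall xs : binvec n, xs \in X ->
     (is_optimal (P_feasible X) (P_objective Gamma k f cbar dc) xs <->
      exists (eta : R) (w : breakpoint cbar dc -> R)
             (z : breakpoint cbar dc -> 'I_n -> R),
        is_optimal (@Q_feasible R n Gamma k X cbar dc)
                   (@Q_objective R n f cbar dc) (QPoint xs eta w z))).
Proof.
have P_le_Q (p : Q_point cbar dc) : @Q_feasible R n Gamma k X cbar dc p ->
    P_objective Gamma k f cbar dc (Q_x p) <= @Q_objective R n f cbar dc p.
  by move=> Fp; rewrite lerD2l (worst_recovery_cost_le_eta hcbar hdc Fp).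
have Q_x_in (p : Q_point cbar dc) :
  @Q_feasible R n Gamma k X cbar dc p -> Q_x p \in X by case: p => ? ? ? ? [].
have lift_optimal x : is_optimal (P_feasible X) (P_objective Gamma k f cbar dc) x ->
    exists w z, is_optimal (@Q_feasible R n Gamma k X cbar dc)
      (@Q_objective R n f cbar dc)
      (QPoint x (worst_recovery_cost Gamma k cbar dc x) w z).
  move=> [Xx minx].
  have [w [z Fwz]] := Q_feasible_lift k hcbar hdc hn hGamma Xx.
  exists w, z; split=> // q Fq; apply: le_trans (P_le_Q q Fq).
  exact: minx (Q_x_in q Fq).
split.
  have /set0Pn[x0 Xx0] := hX.
  have [x optx] : exists x,
      is_optimal (P_feasible X) (P_objective Gamma k f cbar dc) x.
    case: (arg_minP (P_objective Gamma k f cbar dc) Xx0) => x Xx minx.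
    by exists x; split.
  exists (P_objective Gamma k f cbar dc x); split; first by exists x.
  by have [w [z optQ]] := lift_optimal x optx; eexists; first exact: optQ.
move=> xs Xxs; split=> [/lift_optimal[w [z optQ]]|[eta [w [z [Fq minq]]]]].
  by do 3!eexists; exact: optQ.
split=> // x Xx; apply: le_trans (P_le_Q _ Fq) _.
have [w' [z' Fx]] := Q_feasible_lift k hcbar hdc hn hGamma Xx.
exact: minq _ Fx.
Qed.
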